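(* Let $r_0>0$ and let $\gamma\colon(0,r_0]\to[0,1]$ be such that $\gamma(r)\to0$ as $r\to0$. There exists a measurable set $\omega\subset\mathbb R$ such that $\operatorname{Leb}(\mathbb R\setminus\omega)>0$ and such that for every small enough $r>0$, $$\gamma(r)\le\inf_{x\in\mathbb R}\frac{\operatorname{Leb}(B(x,r)\cap\omega)}{\operatorname{Leb}(B(x,r))}.$$ Moreover, if $\gamma$ is (strictly) increasing, one can choose $\omega=\mathbb R\setminus K$, where $K$ is the Smith-Volterra-Cantor set associated with a sequence $(\tau_n)_{n\in\mathbb N}\in(0,1)^{\mathbb N}$ such that $\tau_n=24\big(\gamma(2^{-n})-\gamma(2^{-n-1})\big)$ for all large enough $n$, in which case, in addition, for every small enough $r>0$, $$\inf_{x\in\mathbb R}\frac{\operatorname{Leb}(B(x,r)\cap\omega)}{\operatorname{Leb}(B(x,r))}\le144\,\gamma(12r).$$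
   Context: $\operatorname{Leb}$ is the Lebesgue measure on $\mathbb R$ and $B(x,r)=(x-r,x+r)$; $\mathbb N$ includes $0$. Smith-Volterra-Cantor set: given a sequence $(\tau_n)_{n\in\mathbb N}$ with $0<\tau_n<1$, define closed sets $K_n\subset[0,1]$, each a finite union of disjoint closed intervals, inductively. Set $K_0=[0,1]$. If $K_n=\bigcup_k I_{nk}$ with $I_{nk}=[a_{nk},b_{nk}]$ disjoint closed intervals, remove from each $I_{nk}$ the open middle part of length $\tau_n\operatorname{Leb}(I_{nk})$, i.e. set $b'_{nk}=(a_{nk}(1+\tau_n)+b_{nk}(1-\tau_n))/2$, $a'_{nk}=(a_{nk}(1-\tau_n)+b_{nk}(1+\tau_n))/2$, $I'_{nk}=[a_{nk},b'_{nk}]\cup[a'_{nk},b_{nk}]$, and set $K_{n+1}=\bigcup_k I'_{nk}$. The Smith-Volterra-Cantor set associated with $(\tau_n)_n$ is $K=\bigcap_{n\in\mathbb N}K_n$. *)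

(* Defs.v *)
From HB Require Import structures.
From mathcomp Require Import all_boot all_order all_algebra.
From mathcomp Require Import all_classical all_reals all_analysis.

Set Implicit Arguments.
Unset Strict Implicit.
Unset Printing Implicit Defensive.

Import Order.TTheory GRing.Theory Num.Theory.
Import numFieldNormedType.Exports.

Local Open Scope classical_set_scope.
Local Open Scope ring_scope.

Definition interval_ball (R : realType) (x r : R) : set R :=
  `]x - r, x + r[%classic.

Definition inf_density (R : realType) (omega : set R) (r : R) : \bar R :=
  ereal_inf (range (fun x : R =>
    lebesgue_measure (interval_ball x r `&` omega)
    / lebesgue_measure (interval_ball x r))%E).

(* A closed interval [a, b] is encoded by the pair (a, b); the step removes its
   open middle part of length t * (b - a). *)
Definition svc_step (R : realType) (t : R) (I : R * R) : seq (R * R) :=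
  let: (a, b) := I in
  [:: (a, (a * (1 + t) + b * (1 - t)) / 2);
      ((a * (1 - t) + b * (1 + t)) / 2, b)].

Fixpoint svc_intervals (R : realType) (tau : nat -> R) (n : nat) :
    seq (R * R) :=
  if n is m.+1 then flatten (map (svc_step (tau m)) (svc_intervals tau m))
  else [:: (0, 1)].

Definition svc_level (R : realType) (tau : nat -> R) (n : nat) : set R :=
  \bigcup_(I in [set` svc_intervals tau n]) `[I.1, I.2]%classic.

Definition svc_set (R : realType) (tau : nat -> R) : set R :=
  \bigcap_n svc_level tau n.

(* Main.v *)
Require Import Defs.
From HB Require Import structures.
From mathcomp Require Import all_boot all_order all_algebra.
From mathcomp Require Import all_classical all_reals all_analysis.
From mathcomp Require Import ring lra.

Set Implicit Arguments.
Unset Strict Implicit.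
Unset Printing Implicit Defensive.

Import Order.TTheory GRing.Theory Num.Theory.
Import numFieldNormedType.Exports.

Local Open Scope classical_set_scope.
Local Open Scope ring_scope.

(* A ball of radius r centred at a point y of the Cantor set K, with
   2^-(n+1) < r <= 2^-n, contains at least half of what is removed from the
   n-th level interval I of y: the child of I containing y, together with the
   adjacent half of the gap of I. So it meets the complement of K in measure
   at least |I|/2 (1 - prod_(i >= n) (1 - tau_i)), which is comparable to
   2^-n sum_(i >= n) tau_i; this sum telescopes to 24 gamma(2^-n) since
   gamma tends to 0. Conversely, the complement of K in I has measure at most
   |I| sum_(i >= n) tau_i. For a gamma that is not increasing, the first claim
   is obtained from r + sup_(s <= r) gamma s. *)

(** * One removal step and the iterated descendants of an interval *)

Definition gap_left (R : realType) (t a b : R) : R :=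
  (a * (1 + t) + b * (1 - t)) / 2.

Definition gap_right (R : realType) (t a b : R) : R :=
  (a * (1 - t) + b * (1 + t)) / 2.

Lemma gap_leftE (R : realType) (t a b : R) :
  gap_left t a b - a = (b - a) * (1 - t) / 2.
Proof. by rewrite /gap_left; field. Qed.

Lemma gap_rightE (R : realType) (t a b : R) :
  b - gap_right t a b = (b - a) * (1 - t) / 2.
Proof. by rewrite /gap_right; field. Qed.

Lemma gap_lengthE (R : realType) (t a b : R) :
  gap_right t a b - gap_left t a b = (b - a) * t.
Proof. by rewrite /gap_right /gap_left; field. Qed.

Lemma gap_midE (R : realType) (t a b : R) :
  gap_right t a b + gap_left t a b = a + b.
Proof. by rewrite /gap_right /gap_left; field. Qed.

Lemma gap_ordered (R : realType) (t a b : R) : 0 < t < 1 -> a < b ->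
  [/\ a < gap_left t a b, gap_left t a b < gap_right t a b
    & gap_right t a b < b].
Proof.
move=> t01 ab.
have := gap_leftE t a b; have := gap_rightE t a b; have := gap_lengthE t a b.
have lt0 : 0 < (b - a) * t by apply: mulr_gt0; lra.
have lt1 : 0 < (b - a) * (1 - t) by apply: mulr_gt0; lra.
by split; lra.
Qed.

(* The descendants after [j] steps of an interval [a, b] of the [k]-th level;
   the recursion refines from the top, unlike that of [svc_intervals]. *)
Fixpoint svc_part (R : realType) (tau : nat -> R) (k j : nat) (a b : R)
    : set R :=
  if j is j'.+1 then
    svc_part tau k.+1 j' a (gap_left (tau k) a b) `|`
    svc_part tau k.+1 j' (gap_right (tau k) a b) b
  else `[a, b]%classic.

(** The proportion of its length that a [k]-th level interval keeps after [j] further steps. *)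
Definition svc_ratio (R : realType) (tau : nat -> R) (k j : nat) : R :=
  \prod_(i < j) (1 - tau (k + i)%N).

Lemma svc_ratio0 (R : realType) (tau : nat -> R) k : svc_ratio tau k 0 = 1.
Proof. by rewrite /svc_ratio big_ord0. Qed.

Lemma svc_ratioS (R : realType) (tau : nat -> R) k j :
  svc_ratio tau k j.+1 = (1 - tau k) * svc_ratio tau k.+1 j.
Proof.
rewrite /svc_ratio big_ord_recl addn0; congr (_ * _).
by apply: eq_bigr => i _; rewrite lift0 addnS.
Qed.

(** * Measure of the surviving and of the removed part of an interval *)

Section parts.
Variables (R : realType) (tau : nat -> R).
Hypothesis tau01 : forall n, 0 < tau n < 1.

Lemma svc_ratio_gt0 k j : 0 < svc_ratio tau k j.
Proof. by apply: prodr_gt0 => i _; have := tau01 (k + i); lra. Qed.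

Lemma svc_ratio_le1 k j : svc_ratio tau k j <= 1.
Proof.
elim: j k => [|j IH] k; first by rewrite svc_ratio0.
rewrite svc_ratioS mulr_ile1 ?IH ?(ltW (svc_ratio_gt0 _ _)) //;
  by have := tau01 k; lra.
Qed.

(** The Weierstrass product inequality; it bounds the removed proportion from above. *)
Lemma svc_ratio_ge k j : 1 - \sum_(i < j) tau (k + i)%N <= svc_ratio tau k j.
Proof.
elim: j k => [|j IH] k; first by rewrite big_ord0 svc_ratio0 subr0.
rewrite svc_ratioS big_ord_recl addn0.
have := IH k.+1; have := svc_ratio_le1 k.+1 j; have := tau01 k.
have -> : \sum_(i < j) tau (k + lift ord0 i)%N = \sum_(i < j) tau (k.+1 + i)%N.
  by apply: eq_bigr => i _; rewrite lift0 addnS.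
set s := \sum_(i < j) _; set p := svc_ratio _ _ _; set t := tau k => t01 p1 sp.
have : 0 <= t * (1 - p) by apply: mulr_ge0; lra.
lra.
Qed.

(** Each factor satisfies [1 - t <= 1 / (1 + t)], and a product of terms [1 + t] is at least one
    plus their sum. This bounds the removed proportion from below. *)
Lemma svc_ratio_le k j :
  svc_ratio tau k j * (1 + \sum_(i < j) tau (k + i)%N) <= 1.
Proof.
elim: j k => [|j IH] k; first by rewrite big_ord0 svc_ratio0 addr0 mulr1.
rewrite svc_ratioS big_ord_recl addn0.
have := IH k.+1; have := svc_ratio_gt0 k.+1 j; have := tau01 k.
have -> : \sum_(i < j) tau (k + lift ord0 i)%N = \sum_(i < j) tau (k.+1 + i)%N.
  by apply: eq_bigr => i _; rewrite lift0 addnS.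
have : 0 <= \sum_(i < j) tau (k.+1 + i)%N.
  by apply: sumr_ge0 => i _; have := tau01 (k.+1 + i); lra.
set s := \sum_(i < j) _; set p := svc_ratio _ _ _; set t := tau k.
move=> s0 t01 p0 ps.
(* As [(1 - t) * (1 + t + s) = (1 + s) - t * s - t * t], the left side is [p * (1 + s)] less two
   nonnegative terms. *)
have h1 : 0 <= p * t * s by rewrite !mulr_ge0//; lra.
have h2 : 0 <= p * t * t by rewrite !mulr_ge0//; lra.
lra.
Qed.

Lemma svc_part_sub k j (a b : R) : a < b -> svc_part tau k j a b `<=` `[a, b].
Proof.
elim: j k a b => [|j IH] k a b ab x //=.
have [al lr rb] := gap_ordered (tau01 k) ab.
by case=> [/(IH _ _ _ al)|/(IH _ _ _ rb)]; rewrite /= !in_itv /=; lra.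
Qed.

Lemma measurable_svc_part k j a b : measurable (svc_part tau k j a b).
Proof. by elim: j k a b => [|j IH] k a b /=; [|apply: measurableU]. Qed.

(** With refinement from the top, both sides split along the same gap, and the induction ends at
    [svc_part_sub]. *)
Lemma svc_partS k j (a b : R) : a < b ->
  svc_part tau k j.+1 a b `<=` svc_part tau k j a b.
Proof.
elim: j k a b => [|j IH] k a b ab; first exact: svc_part_sub.
have [al lr rb] := gap_ordered (tau01 k) ab.
by apply: setUSS; apply: IH; lra.
Qed.

Lemma lebesgue_measure_svc_part_le k j (a b : R) : a < b ->
  (lebesgue_measure (svc_part tau k j a b) <= ((b - a) * svc_ratio tau k j)%:E)%E.
Proof.
elim: j k a b => [|j IH] k a b ab.
  by rewrite /= lebesgue_measure_itv /= lte_fin ab svc_ratio0 mulr1 EFinB.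
have [al lr rb] := gap_ordered (tau01 k) ab.
apply: (le_trans (measureU2 _ _ _)); try exact: measurable_svc_part.
apply: (le_trans (leeD (IH _ _ _ al) (IH _ _ _ rb))).
by rewrite -EFinD lee_fin gap_leftE gap_rightE svc_ratioS; lra.
Qed.

(** The part and its complement cover [[a, b]], so the upper bound on the part turns into a lower
    bound on what is removed. *)
Lemma lebesgue_measure_svc_partC_ge k j (a b : R) : a < b ->
  (((b - a) * (1 - svc_ratio tau k j))%:E <=
   lebesgue_measure (`[a, b] `\` svc_part tau k j a b))%E.
Proof.
move=> ab; have mp := measurable_svc_part k j a b.
have mD : measurable (`[a, b] `\` svc_part tau k j a b).
  exact: measurableD.
have : (lebesgue_measure `[a, b]%classic <=
    lebesgue_measure (svc_part tau k j a b) +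
    lebesgue_measure (`[a, b] `\` svc_part tau k j a b))%E.
  apply: (le_trans _ (measureU2 lebesgue_measure mp mD)).
  apply: le_measure; rewrite ?inE //; first exact: measurableU.
  by move=> x xab; have [?|?] := pselect (svc_part tau k j a b x); [left|right].
rewrite /= lebesgue_measure_itv /= lte_fin ab -EFinB => h.
rewrite (_ : _ * _ = (b - a) - (b - a) * svc_ratio tau k j); last by ring.
rewrite EFinB leeBlDl //; apply: (le_trans h).
by apply: leeD => //; exact: lebesgue_measure_svc_part_le.
Qed.

(** A removed point lies in the middle gap or is removed from a child. With [t = tau k] and [q] the
    ratio of the children, [t + (1 - t) * (1 - q) = 1 - (1 - t) * q]. *)
Lemma lebesgue_measure_svc_partC_le k j (a b : R) : a < b ->
  (lebesgue_measure (`[a, b] `\` svc_part tau k j a b) <=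
   ((b - a) * (1 - svc_ratio tau k j))%:E)%E.
Proof.
elim: j k a b => [|j IH] k a b ab.
  by rewrite /= setDv measure0 svc_ratio0 subrr mulr0.
have [al lr rb] := gap_ordered (tau01 k) ab.
set l := gap_left _ _ _ in al lr *; set r := gap_right _ _ _ in rb lr *.
set L := svc_part tau k.+1 j a l; set P := svc_part tau k.+1 j r b.
have mL : measurable (`[a, l] `\` L).
  by apply: measurableD => //; exact: measurable_svc_part.
have mP : measurable (`[r, b] `\` P).
  by apply: measurableD => //; exact: measurable_svc_part.
have gap_le : (lebesgue_measure `]l, r[%classic <= ((b - a) * tau k)%:E)%E.
  by rewrite lebesgue_measure_itv /= lte_fin lr -EFinB gap_lengthE.
have sub : `[a, b] `\` (L `|` P) `<=`
    `]l, r[ `|` ((`[a, l] `\` L) `|` (`[r, b] `\` P)).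
  move=> x [] /=; rewrite !in_itv /= => xab /not_orP[xL xP].
  have [xl|xl] := leP x l; first by right; left; split=> //; lra.
  have [xr|xr] := leP r x; first by right; right; split=> //; lra.
  by left.
apply: (@le_trans _ _ (lebesgue_measure
    (`]l, r[ `|` ((`[a, l] `\` L) `|` (`[r, b] `\` P))))).
  apply: le_measure; rewrite ?inE //.
    by apply: measurableD => //; exact: (measurable_svc_part k j.+1).
  by apply: measurableU => //; exact: measurableU.
apply: (le_trans (measureU2 _ _ _)) => //; first exact: measurableU.
apply: (le_trans (leeD (le_refl _) (measureU2 _ _ _))) => //.
apply: (le_trans (leeD gap_le (leeD (IH _ _ _ al) (IH _ _ _ rb)))).
rewrite -!EFinD lee_fin gap_leftE gap_rightE svc_ratioS; lra.
Qed.

End parts.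

(** * Removed measure in a ball centred in the surviving part *)

Lemma lebesgue_measureU_ge (R : realType) (A B C : set R) (x y : R) :
  measurable A -> measurable B -> measurable C ->
  A `<=` C -> B `<=` C -> A `&` B = set0 ->
  (x%:E <= lebesgue_measure A)%E -> (y%:E <= lebesgue_measure B)%E ->
  ((x + y)%:E <= lebesgue_measure C)%E.
Proof.
move=> mA mB mC AC BC AB0 xA yB.
apply: (@le_trans _ _ (lebesgue_measure (A `|` B))).
  by rewrite measureU // EFinD; exact: leeD.
apply: le_measure; rewrite ?inE //; first exact: measurableU.
by move=> z [/AC|/BC].
Qed.

Section ball.
Variables (R : realType) (tau : nat -> R).
Hypothesis tau01 : forall n, 0 < tau n < 1.

Let measurable_target k j (a b y r : R) :
  measurable (interval_ball y r `&` (`[a, b] `\` svc_part tau k j a b)).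
Proof.
apply: measurableI; first exact: measurable_itv.
by apply: measurableD => //; exact: measurable_svc_part.
Qed.

(* As [r] is at least half the length of the interval, the ball contains the
   whole child of [y] and the half of the middle gap adjacent to it. *)
Lemma svc_part_ball0 k j (a b y r : R) : a < b ->
  svc_part tau k j a b y -> (b - a) / 2 <= r ->
  (((b - a) / 2 * (1 - svc_ratio tau k j))%:E <=
   lebesgue_measure
     (interval_ball y r `&` (`[a, b] `\` svc_part tau k j a b)))%E.
Proof.
case: j => [|j] ab.
  by rewrite svc_ratio0 subrr mulr0 => _ _; exact: measure_ge0.
move=> yE lr; have mT := measurable_target k j.+1 a b y r.
move: yE mT => /=; have [al lu ub] := gap_ordered (tau01 k) ab.
have hl := gap_leftE (tau k) a b; have hu := gap_rightE (tau k) a b.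
have hg := gap_lengthE (tau k) a b; have hm := gap_midE (tau k) a b.
move: al lu ub hl hu hg hm.
set l := gap_left _ _ _; set u := gap_right _ _ _.
set L := svc_part tau k.+1 j a l; set P := svc_part tau k.+1 j u b.
move=> al lu ub hl hu hg hm yLP mT.
have LI : L `<=` `[a, l] := svc_part_sub tau01 al.
have PI : P `<=` `[u, b] := svc_part_sub tau01 ub.
have := svc_ratio_gt0 tau01 k.+1 j.
have [yL|yP] := yLP.
- have := LI _ yL; rewrite /= in_itv /= => yal p0.
  (* The first summand is the half gap, of length [(b - a) * tau k / 2]; the second bounds what is
     removed inside the child [[a, l]]. *)
  have -> : (b - a) / 2 * (1 - svc_ratio tau k j.+1) =
      ((a + b) / 2 - l) + (l - a) * (1 - svc_ratio tau k.+1 j).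
    by rewrite hl svc_ratioS; lra.
  apply: (@lebesgue_measureU_ge _ `]l, (a + b) / 2[%classic (`[a, l] `\` L)).
  + exact: measurable_itv.
  + by apply: measurableD => //; exact: measurable_svc_part.
  + exact: mT.
  + move=> x; rewrite /interval_ball /= !in_itv /= => lx.
    split; first by lra.
    split; first by lra.
    by case=> [/LI|/PI]; rewrite /= in_itv /=; lra.
  + move=> x []; rewrite /interval_ball /= !in_itv /= => ax xL.
    split; first by lra.
    split; first by lra.
    by case=> [//|/PI]; rewrite /= in_itv /=; lra.
  + by apply/seteqP; split=> // x [] /=; rewrite !in_itv /= => ? [] ?; lra.
  + rewrite lebesgue_measure_itv /= lte_fin.
    by have -> : l < (a + b) / 2 by lra.
  + exact: lebesgue_measure_svc_partC_ge.
- have := PI _ yP; rewrite /= in_itv /= => yub p0.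
  have -> : (b - a) / 2 * (1 - svc_ratio tau k j.+1) =
      (u - (a + b) / 2) + (b - u) * (1 - svc_ratio tau k.+1 j).
    by rewrite hu svc_ratioS; lra.
  apply: (@lebesgue_measureU_ge _ `](a + b) / 2, u[%classic (`[u, b] `\` P)).
  + exact: measurable_itv.
  + by apply: measurableD => //; exact: measurable_svc_part.
  + exact: mT.
  + move=> x; rewrite /interval_ball /= !in_itv /= => lx.
    split; first by lra.
    split; first by lra.
    by case=> [/LI|/PI]; rewrite /= in_itv /=; lra.
  + move=> x []; rewrite /interval_ball /= !in_itv /= => ax xL.
    split; first by lra.
    split; first by lra.
    by case=> [/LI|//]; rewrite /= in_itv /=; lra.
  + by apply/seteqP; split=> // x [] /=; rewrite !in_itv /= => ? [] ?; lra.
  + rewrite lebesgue_measure_itv /= lte_fin.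
    by have -> : (a + b) / 2 < u by lra.
  + exact: lebesgue_measure_svc_partC_ge.
Qed.

(** Descend [n] levels along the intervals containing [y], down to one whose half length is the
    threshold for [r], and apply [svc_part_ball0] there. What is removed from a child is also
    removed from its parent, because the sibling lies beyond the gap. *)
Lemma svc_part_ball n j k (a b y r : R) : a < b ->
  svc_part tau k (n + j) a b y ->
  (b - a) * svc_ratio tau k n / 2 ^+ n.+1 <= r ->
  (((b - a) * svc_ratio tau k n / 2 ^+ n.+1
      * (1 - svc_ratio tau (k + n) j))%:E <=
   lebesgue_measure
     (interval_ball y r `&` (`[a, b] `\` svc_part tau k (n + j) a b)))%E.
Proof.
elim: n k a b => [|n IH] k a b ab.
  by rewrite svc_ratio0 mulr1 expr1 addn0 add0n; exact: svc_part_ball0.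
have [al lu ub] := gap_ordered (tau01 k) ab.
have lenE c : c = (b - a) * (1 - tau k) / 2 ->
    (b - a) * svc_ratio tau k n.+1 / 2 ^+ n.+2 =
    c * svc_ratio tau k.+1 n / 2 ^+ n.+1.
  by move=> ->; rewrite svc_ratioS [2 ^+ n.+2]exprS; field.
have mT := measurable_target k (n.+1 + j) a b y r.
move: mT => /= mT [] yE.
- rewrite (lenE _ (gap_leftE _ _ _)) addnS -addSn => lr.
  apply: le_trans (IH _ _ _ al yE lr) _.
  apply: le_measure; rewrite ?inE //; first exact: measurable_target.
  move=> x [xy [xal xE]]; split=> //; move: xal; rewrite /= in_itv /= => xal.
  split; first by rewrite in_itv /=; lra.
  by case=> // /(svc_part_sub tau01 ub); rewrite /= in_itv /=; lra.
- rewrite (lenE _ (gap_rightE _ _ _)) addnS -addSn => lr.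
  apply: le_trans (IH _ _ _ ub yE lr) _.
  apply: le_measure; rewrite ?inE //; first exact: measurable_target.
  move=> x [xy [xub xE]]; split=> //; move: xub; rewrite /= in_itv /= => xub.
  split; first by rewrite in_itv /=; lra.
  by case=> // /(svc_part_sub tau01 al); rewrite /= in_itv /=; lra.
Qed.

End ball.

(** * Comparison with the levels of the Smith-Volterra-Cantor set *)

(** Reconciles the two recursions: each induction step trades the first subdivision in [svc_part]
    for the last one in [svc_intervals]. *)
Lemma svc_level_part (R : realType) (tau : nat -> R) n j :
  svc_level tau (n + j) =
  \bigcup_(I in [set` svc_intervals tau n]) svc_part tau n j I.1 I.2.
Proof.
elim: j n => [|j IH] n; first by rewrite addn0.
rewrite addnS -addSn IH; apply/seteqP; split => x [] [a b] /=.
- move=> /flattenP[s /mapP[[c d] cdn ->]] /=.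
  rewrite !inE => /orP[] /eqP[-> ->] xI; exists (c, d) => //=; [left|right];
    exact: xI.
- move=> abn [] xI; [exists (a, gap_left (tau n) a b)|
                     exists (gap_right (tau n) a b, b)] => //=;
  by apply/flattenP; exists (svc_step (tau n) (a, b));
    rewrite ?map_f // !inE eqxx ?orbT.
Qed.

Lemma svc_level01 (R : realType) (tau : nat -> R) n :
  svc_level tau n = svc_part tau 0 n 0 1.
Proof.
rewrite -[n]add0n svc_level_part add0n /=.
apply/seteqP; split => x; first by move=> [I]; rewrite /= inE => /eqP->.
by move=> xE; exists (0, 1) => //=; rewrite inE.
Qed.

(** An explicit interval of each level; the ball that bounds the infimum from above is centred at
    its midpoint. *)
Lemma svc_intervals_leftmost (R : realType) (tau : nat -> R) n :
  (0, svc_ratio tau 0 n / 2 ^+ n) \in svc_intervals tau n.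
Proof.
elim: n => [|n IH]; first by rewrite /= svc_ratio0 expr0 divr1 inE.
apply/flattenP; exists (svc_step (tau n) (0, svc_ratio tau 0 n / 2 ^+ n)).
  exact: map_f.
rewrite /= !inE; apply/orP; left; apply/eqP; congr pair.
rewrite mul0r add0r {1}/svc_ratio big_ord_recr /= add0n exprS.
by rewrite -/(svc_ratio _ 0 _) /svc_ratio; field; rewrite expf_neq0.
Qed.

Lemma measurable_svc_set (R : realType) (tau : nat -> R) :
  measurable (svc_set tau).
Proof.
apply: bigcap_measurableType => n _.
by rewrite svc_level01; exact: measurable_svc_part.
Qed.

Lemma subset_svc_level (R : realType) (tau : nat -> R) m n :
  (forall n, 0 < tau n < 1) -> (m <= n)%N ->
  svc_level tau n `<=` svc_level tau m.
Proof.
move=> tau01 /subnK <-; elim: (n - m)%N => [//|j IH].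
apply: subset_trans IH; rewrite addSn !svc_level01.
exact: svc_partS.
Qed.

(** * Densities of balls and dyadic scales *)

Lemma lebesgue_measure_interval_ball (R : realType) (x r : R) : 0 < r ->
  lebesgue_measure (interval_ball x r) = (2 * r)%:E.
Proof.
move=> r0; rewrite /interval_ball lebesgue_measure_itv /= lte_fin.
by rewrite ifT -?EFinB; [congr EFin; ring | lra].
Qed.

Lemma inf_density_ge (R : realType) (omega : set R) (r c : R) : 0 < r ->
  (forall x,
     ((c * (2 * r))%:E <= lebesgue_measure (interval_ball x r `&` omega))%E) ->
  (c%:E <= inf_density omega r)%E.
Proof.
move=> r0 h; apply/ereal_infP => _ [x _ <-].
have r20 : 0 < 2 * r by lra.
rewrite lebesgue_measure_interval_ball // inver gt_eqF //.
by rewrite lee_pdivlMr // -EFinM.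
Qed.

Lemma inf_density_le (R : realType) (omega : set R) (x r c : R) : 0 < r ->
  (lebesgue_measure (interval_ball x r `&` omega) <= (c * (2 * r))%:E)%E ->
  (inf_density omega r <= c%:E)%E.
Proof.
move=> r0 h; apply: ge_ereal_inf; eexists; first by exists x.
have r20 : 0 < 2 * r by lra.
rewrite lebesgue_measure_interval_ball // inver gt_eqF //.
by rewrite lee_pdivrMr // -EFinM.
Qed.

Lemma dyadic_lt (R : realType) (e : R) : 0 < e -> exists n, 2 ^- n < e.
Proof.
move=> e0; have [n _ h] := near_infty_natSinv_expn_lt (PosNum e0).
by exists n; have := h n (leqnn n); rewrite /= div1r.
Qed.

Lemma dyadic_between (R : realType) (r : R) : 0 < r <= 1 ->
  exists n, 2 ^- n.+1 < r <= 2 ^- n.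
Proof.
move=> /andP[r0 r1].
have ex : exists n, (2 ^- n.+1 : R) < r.
  have [n nr] := dyadic_lt r0; exists n; apply: le_lt_trans nr.
  by rewrite lef_pV2 ?posrE ?exprn_gt0 // ler_eXn2l //; lra.
(* Minimality of the exponent gives the upper bound, except when the least exponent is [0], where
   [r <= 1] gives it. *)
case: (ex_minnP ex) => -[|n] nr nmin; [exists 0%N|exists n.+1].
  by rewrite nr expr0 invr1.
by rewrite nr leNgt; apply/negP => /nmin; rewrite ltnn.
Qed.

(** * Measure of the Cantor set and of its complement in balls *)

Section density.
Variables (R : realType) (tau : nat -> R).
Hypothesis tau01 : forall n, 0 < tau n < 1.

(** Continuity of the measure from below: the complements of the levels increase to that of
    [svc_set]. *)
Lemma lebesgue_measure_svc_setC_le n (a b c : R) : a < b ->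
  (a, b) \in svc_intervals tau n ->
  (forall j, (b - a) * (1 - svc_ratio tau n j) <= c) ->
  (lebesgue_measure (`[a, b] `\` svc_set tau) <= c%:E)%E.
Proof.
move=> ab abn h.
have mF j : measurable (`[a, b] `\` svc_level tau (n + j)).
  by apply: measurableD => //; rewrite svc_level01; exact: measurable_svc_part.
have FE : `[a, b] `\` svc_set tau =
    \bigcup_j (`[a, b] `\` svc_level tau (n + j)).
  apply/seteqP; split => x /=.
    move=> [xab]; rewrite /svc_set /bigcap /= => /existsNP[m /not_implyP[_ xm]].
    exists m => //; split=> // /(subset_svc_level tau01 (leq_addl n m)).
    exact: xm.
  by move=> [j _ [xab xj]]; split=> // xK; apply: xj; exact: xK.
have mU : measurable (\bigcup_j (`[a, b] `\` svc_level tau (n + j))).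
  exact: bigcup_measurable.
have ndF : {homo (fun j => `[a, b] `\` svc_level tau (n + j)) : i j /
    (i <= j)%N >-> (i <= j)%O}.
  move=> i j ij; apply/subsetPset => x [xab xi]; split=> // xj; apply: xi.
  by apply: (subset_svc_level tau01 _ xj); rewrite leq_add2l.
have := nondecreasing_cvg_mu (mu := lebesgue_measure) mF mU ndF.
rewrite FE => cF; rewrite -(cvg_lim _ cF) //.
apply: lime_le; first by apply/cvg_ex; eexists; exact: cF.
apply: nearW => j /=.
(* The descendants of [[a, b]] are among those making up level [n + j], so removing only them leaves
   a larger set. *)
apply: (@le_trans _ _
    (lebesgue_measure (`[a, b] `\` svc_part tau n j a b))).
  apply: le_measure; rewrite ?inE.
  - exact: mF.
  - by apply: measurableD => //; exact: measurable_svc_part.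
  move=> x [xab xj]; split=> // xp; apply: xj.
  by rewrite svc_level_part; exists (a, b).
apply: le_trans (lebesgue_measure_svc_partC_le tau01 _ _ ab) _.
by rewrite lee_fin.
Qed.

Hypothesis tau_sum : forall m, \sum_(i < m) tau i <= 1 / 8.

(** Together with [svc_ratio_le1], this puts the length of a level [n] interval between
    [7 / 8 * 2 ^- n] and [2 ^- n]. *)
Lemma svc_ratio_ge78 n : 7 / 8 <= svc_ratio tau 0 n.
Proof.
have := svc_ratio_ge tau01 0 n; have := tau_sum n.
by under eq_bigr do rewrite -[X in tau X]add0n; lra.
Qed.

(** At most [1 / 8] of [[0, 1]] is ever removed. *)
Lemma svc_set_gt0 : (0 < lebesgue_measure (svc_set tau))%E.
Proof.
have mK := measurable_svc_set tau.
have mD : measurable (`[0, 1] `\` svc_set tau) by exact: measurableD.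
have D8 : (lebesgue_measure (`[0%R, 1%R] `\` svc_set tau) <= (1 / 8)%:E)%E.
  apply: (@lebesgue_measure_svc_setC_le 0) => //; first by rewrite /= inE.
  by move=> j; have := svc_ratio_ge78 j; lra.
have : (lebesgue_measure `[0%R, 1%R]%classic <=
    lebesgue_measure (svc_set tau) +
    lebesgue_measure (`[0%R, 1%R] `\` svc_set tau))%E.
  apply: (le_trans _ (measureU2 lebesgue_measure mK mD)).
  apply: le_measure; rewrite ?inE //; first exact: measurableU.
  by move=> x x01; have [?|?] := pselect (svc_set tau x); [left|right].
rewrite lebesgue_measure_itv /= lte_fin ltr01 => h.
have {h} : (1%:E <= lebesgue_measure (svc_set tau) + (1 / 8)%:E)%E.
  by apply: le_trans (leeD (le_refl _) D8); rewrite -[X in (X <= _)%E]sube0.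
rewrite -leeBlDr // -EFinB; apply: lt_le_trans.
by rewrite lte_fin; lra.
Qed.

(* If [x] is within [M] of some [y] in the Cantor set, then the balls around
   [x] and [y] differ by measure at most [M]; otherwise the [M]-ball around [x]
   misses the Cantor set. *)
Lemma svc_setC_ball n j (x r M : R) :
  2 ^- n.+1 <= r -> 0 < M <= r ->
  6 * M <= 2 ^- n * \sum_(i < j) tau (n + i)%N ->
  (M%:E <= lebesgue_measure (interval_ball x r `&` ~` svc_set tau))%E.
Proof.
move=> nr /andP[M0 Mr] MS.
have mK := measurable_svc_set tau.
have mT : measurable (interval_ball x r `&` ~` svc_set tau).
  by apply: measurableI; [exact: measurable_itv|exact: measurableC].
have [[y [yK xy]]|noy] := pselect (exists y, svc_set tau y /\ `|x - y| <= M);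
  last first.
  apply: (@le_trans _ _ (lebesgue_measure (interval_ball x M))).
    by rewrite lebesgue_measure_interval_ball // lee_fin; lra.
  apply: le_measure; rewrite ?inE //; first exact: measurable_itv.
  move=> y; rewrite /interval_ball /= !in_itv /= => xMy; split; first by lra.
  by move=> yK; apply: noy; exists y; split=> //; rewrite ler_norml; lra.
(* [E] catches the part of the ball at [y] that sticks out of the ball at [x]: an interval of length
   [|x - y|]. *)
have [E [mE EM ballE]] : exists E : set R,
    [/\ measurable E, (lebesgue_measure E <= M%:E)%E
      & interval_ball y r `<=` interval_ball x r `|` E].
  move: xy; rewrite ler_norml => xy; have [yx|yx] := leP y x.
  - exists `]y - r, x - r]%classic; split; first exact: measurable_itv.
      rewrite lebesgue_measure_itv /= lte_fin; case: ifP => _.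
        by rewrite -EFinB lee_fin; lra.
      by rewrite lee_fin ltW.
    move=> z; rewrite /interval_ball /= !in_itv /= => zy.
    by have [?|?] := leP z (x - r); [right|left]; lra.
  - exists `[x + r, y + r[%classic; split; first exact: measurable_itv.
      rewrite lebesgue_measure_itv /= lte_fin; case: ifP => _.
        by rewrite -EFinB lee_fin; lra.
      by rewrite lee_fin ltW.
    move=> z; rewrite /interval_ball /= !in_itv /= => zy.
    by have [?|?] := leP (x + r) z; [right|left]; lra.
have yp : svc_part tau 0 (n + j) 0 1 y by rewrite -svc_level01; exact: yK.
have p78 := svc_ratio_ge78 n; have p1 := svc_ratio_le1 tau01 0 n.
have w0 : 0 < 2 ^- n :> R by rewrite invr_gt0 exprn_gt0.
have wE : 2 ^- n.+1 = 2 ^- n / 2 :> R by rewrite exprS invfM mulrC.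
(* Removed measure [2 * M] around [y] leaves [M] around [x] once [E] is discarded. *)
have M2 : 2 * M <= (1 - 0) * svc_ratio tau 0 n / 2 ^+ n.+1
    * (1 - svc_ratio tau (0 + n) j).
  have q0 := svc_ratio_gt0 tau01 n j; have qS := svc_ratio_le tau01 n j.
  have q1 := svc_ratio_le1 tau01 n j.
  have S8 : \sum_(i < j) tau (n + i)%N <= 1 / 8.
    apply: le_trans (tau_sum (n + j)); rewrite big_split_ord /= lerDr.
    by apply: sumr_ge0 => i _; have := tau01 i; lra.
  have S0 : 0 <= \sum_(i < j) tau (n + i)%N.
    by apply: sumr_ge0 => i _; have := tau01 (n + i); lra.
  move: MS q0 qS q1 S8 S0 p78 p1; rewrite wE add0n subr0 mul1r.
  set S := \sum_(i < j) _; set q := svc_ratio _ _ _; set p := svc_ratio _ _ _.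
  set w := 2 ^- n in w0 * => MS q0 qS q1 S8 S0 p78 p1.
  (* From [q * (1 + S) <= 1] and [S <= 1 / 8] follows [1 - q >= 8 / 9 * S]. With [p >= 7 / 8] the
     right side is at least [7 / 18 * (w * S)], while the factor [6] in [MS] gives
     [2 * M <= 6 / 18 * (w * S)]. *)
  have h1 : 0 <= (1 - q) * (1 / 8 - S) by apply: mulr_ge0; lra.
  have h2 : 8 / 9 * S <= 1 - q by lra.
  have h3 : 0 <= w * (1 - q - 8 / 9 * S) by apply: mulr_ge0; lra.
  have h4 : 0 <= (p - 7 / 8) * (w * (1 - q)) by rewrite !mulr_ge0 //; lra.
  have h5 : 0 <= w * S by apply: mulr_ge0; lra.
  lra.
have /(svc_part_ball tau01 ltr01 yp) h :
    (1 - 0) * svc_ratio tau 0 n / 2 ^+ n.+1 <= r.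
  by apply: le_trans nr; rewrite subr0 mul1r ler_piMl // wE; lra.
have : ((2 * M)%:E <=
    lebesgue_measure (interval_ball x r `&` ~` svc_set tau) + M%:E)%E.
  apply: (@le_trans _ _ (((1 - 0) * svc_ratio tau 0 n / 2 ^+ n.+1
    * (1 - svc_ratio tau (0 + n) j))%:E)); first by rewrite lee_fin.
  apply: (le_trans h).
  apply: le_trans (leeD (le_refl _) EM).
  apply: le_trans (measureU2 lebesgue_measure mT mE).
  apply: le_measure; rewrite ?inE //.
  - apply: measurableI; first exact: measurable_itv.
    by apply: measurableD => //; exact: measurable_svc_part.
  - exact: measurableU.
  - move=> z [/ballE[zx|zE] [_ zp]]; last by right.
    left; split=> // zK; apply: zp; rewrite -svc_level01.
    exact: zK.
rewrite -leeBlDr // -EFinB; apply: le_trans.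
by rewrite lee_fin; lra.
Qed.

End density.

(** * Choice of the ratios for a strictly increasing [gamma] *)

Lemma dyadic_ltn (R : realType) m n : (2 ^- n < 2 ^- m :> R) = (m < n)%N.
Proof.
by rewrite ltf_pV2 ?posrE ?exprn_gt0 // ltr_eXn2l // ltr1n.
Qed.

Lemma cvg0_right_lt (R : realType) (f : R -> R) (r0 e : R) :
  0 < r0 -> f r @[r --> 0^'+] --> 0 -> 0 < e ->
  exists2 d, 0 < d <= r0 & forall r, 0 < r <= d -> f r < e.
Proof.
move=> r0_gt0 f0 e0; have /cvgrPdist_lt/(_ e e0) [d /= d0 dP] := f0.
exists (Num.min (d / 2) r0) => [|r /andP[r_gt0]].
  by rewrite lt_min r0_gt0 ge_min lexx orbT divr_gt0.
rewrite le_min => /andP[rd _]; have := dP r.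
rewrite /= sub0r normrN gtr0_norm // => /(_ ltac:(lra) r_gt0).
by rewrite sub0r normrN => /ltr_normlW.
Qed.

(** The strictly increasing case, from which both claims of the theorem follow. The ratios are
    prescribed for large [n] only; the first ones are chosen small, to keep all partial sums at most
    [1 / 8]. *)
Lemma svc_density (R : realType) (r0 : R) (gamma : R -> R)
    (r0_gt0 : 0 < r0)
    (gamma01 : forall r, 0 < r <= r0 -> 0 <= gamma r <= 1)
    (gamma_cvg0 : gamma r @[r --> 0^'+] --> 0)
    (gamma_incr : forall r s, 0 < r -> r < s -> s <= r0 -> gamma r < gamma s) :
  exists tau : nat -> R,
    [/\ forall n, 0 < tau n < 1,
        \forall n \near \oo, tau n = 24 * (gamma (2 ^- n) - gamma (2 ^- n.+1)),
        (0 < lebesgue_measure (svc_set tau))%E,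
        \forall r \near 0^'+, ((gamma r)%:E <= inf_density (~` svc_set tau) r)%E
      & \forall r \near 0^'+,
          (inf_density (~` svc_set tau) r <= (144 * gamma (12 * r))%:E)%E].
Proof.
have gamma_small := cvg0_right_lt r0_gt0 gamma_cvg0.
have gamma_gt0 r : 0 < r <= r0 -> 0 < gamma r.
  move=> rr0; have := @gamma_incr (r / 2) r; have := gamma01 (r / 2).
  by move=> h1 h2; have := h1 ltac:(lra); have := h2 ltac:(lra) ltac:(lra)
    ltac:(lra); lra.
have dy0 n : 0 < 2 ^- n :> R by rewrite invr_gt0 exprn_gt0.
(* Since [24 / 384 = 1 / 16], the telescoped tail of the ratios stays below [1 / 16], which leaves
   [1 / 16] for the first [N] of them. *)
have [d /andP[d0 dr0] dP] : exists2 d, 0 < d <= r0 &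
    forall r, 0 < r <= d -> gamma r < 1 / 384 by apply: gamma_small; lra.
have [N Nd] := dyadic_lt d0.
have dy_r0 n : (N <= n)%N -> 2 ^- n <= r0 :> R.
  rewrite leq_eqVlt => /orP[/eqP<-|]; first by lra.
  by rewrite -(dyadic_ltn R); lra.
have g384 n : (N <= n)%N -> gamma (2 ^- n) < 1 / 384.
  move=> Nn; apply: dP; rewrite dy0; move: Nn.
  rewrite leq_eqVlt => /orP[/eqP<-|]; first by lra.
  by rewrite -(dyadic_ltn R); lra.
(* [N.+1] in place of [N] keeps [eta] positive when [N] is [0]. *)
pose eta : R := (16 * N.+1%:R)^-1.
have N1 : 1 <= N.+1%:R :> R by rewrite ler1n.
have etaE : eta * (16 * N.+1%:R) = 1 by rewrite mulVf //; lra.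
have eta0 : 0 < eta by rewrite invr_gt0; lra.
have etaN : eta * N.+1%:R = 1 / 16 by lra.
pose tau n : R :=
  if (n < N)%N then eta else 24 * (gamma (2 ^- n) - gamma (2 ^- n.+1)).
have tauE n : (N <= n)%N -> tau n = 24 * (gamma (2 ^- n) - gamma (2 ^- n.+1)).
  by rewrite /tau ltnNge => ->.
have tau01 n : 0 < tau n < 1.
  have [Nn|nN] := leqP N n.
    rewrite tauE //; have := g384 _ Nn.
    have : gamma (2 ^- n.+1) < gamma (2 ^- n).
      by apply: gamma_incr; rewrite ?dyadic_ltn // dy_r0.
    have := gamma_gt0 (2 ^- n.+1); rewrite dy0 dy_r0 ?(leqW Nn) //.
    by move=> /(_ isT); lra.
  rewrite /tau nN eta0 /=.
  have : 0 <= eta * (N.+1%:R - 1) by apply: mulr_ge0; lra.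
  lra.
have tau_tail n j : (N <= n)%N ->
    \sum_(i < j) tau (n + i)%N = 24 * (gamma (2 ^- n) - gamma (2 ^- (n + j))).
  move=> Nn; elim: j => [|j IH]; first by rewrite big_ord0 addn0 subrr mulr0.
  rewrite big_ord_recr /= IH tauE; last exact: leq_trans (leq_addr _ _).
  by rewrite addnS; ring.
have tau_head m : (m <= N)%N -> \sum_(i < m) tau i <= 1 / 16.
  move=> mN; rewrite (eq_bigr (fun=> eta)) => [|i _]; last first.
    by rewrite /tau (leq_trans (ltn_ord i) mN).
  rewrite sumr_const card_ord -etaN -[eta *+ m]mulr_natr ler_pM2l // ler_nat.
  exact: leqW.
have tau_sum m : \sum_(i < m) tau i <= 1 / 8.
  have [mN|Nm] := leqP m N; first by apply: le_trans (tau_head _ mN) _; lra.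
  rewrite -(subnKC (ltnW Nm)) big_split_ord /=.
  have := tau_head _ (leqnn N); rewrite tau_tail //.
  have := g384 _ (leqnn N); have := gamma_gt0 (2 ^- (N + (m - N))).
  by rewrite dy0 dy_r0 ?leq_addr // => /(_ isT); lra.
have dy1 n : 2 ^- n <= 1 :> R by rewrite invf_le1 ?exprn_gt0 // exprn_ege1 // ler1n.
exists tau; split=> //.
- by exists N => // n /= /tauE.
- exact: svc_set_gt0.
- near=> r.
  have r_gt0 : 0 < r by [].
  have rN : r < 2 ^- N by near: r; exact: nbhs_right_lt.
  have [n /andP[nr rn]] : exists n, 2 ^- n.+1 < r <= 2 ^- n.
    by apply: dyadic_between; have := dy1 N; lra.
  have Nn : (N <= n)%N by rewrite -ltnS -(dyadic_ltn R); exact: lt_trans rN.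
  have gr0 : 0 < gamma r by apply: gamma_gt0; have := dy_r0 N (leqnn N); lra.
  have grn : gamma r <= gamma (2 ^- n).
    move: rn; rewrite le_eqVlt => /orP[/eqP->//|rn].
    by apply/ltW/gamma_incr => //; exact: dy_r0.
  have gn := g384 _ Nn.
  (* [j] is taken so large that the telescoped sum reaches [12 * gamma (2 ^- n)], half of its limit.
     This matches [6 * M = 12 * r * gamma r] for [M = gamma r * (2 * r)], whence the constant
     [24]. *)
  have [d' /andP[d'0 _] d'P] : exists2 d', 0 < d' <= r0 &
      forall r, 0 < r <= d' -> gamma r < gamma (2 ^- n) / 2.
    by apply: gamma_small; lra.
  have [j jd'] := dyadic_lt d'0.
  have gnj : gamma (2 ^- (n + j)) < gamma (2 ^- n) / 2.
    apply: d'P; rewrite dy0 /=; apply: le_trans (ltW jd').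
    by rewrite lef_pV2 ?posrE ?exprn_gt0 // ler_eXn2l ?ltr1n // leq_addl.
  apply: inf_density_ge => // x.
  have h1 : 0 <= r * (1 / 384 - gamma r) by apply: mulr_ge0; lra.
  have h2 : 0 < gamma r * (2 * r) by rewrite !mulr_gt0.
  apply: (@svc_setC_ball _ _ tau01 tau_sum n j); [exact: ltW|lra|].
  rewrite tau_tail //.
  have : 12 * (r * gamma r) <= 12 * (2 ^- n * gamma (2 ^- n)).
    by rewrite ler_pM2l // ler_pM // ltW.
  have : 0 <= 2 ^- n * (gamma (2 ^- n) - 2 * gamma (2 ^- (n + j))).
    by apply: mulr_ge0; [exact: ltW|lra].
  lra.
- near=> r.
  have r_gt0 : 0 < r by [].
  have rN : r < 2 ^- N / 12 by near: r; apply: nbhs_right_lt; rewrite divr_gt0.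
  (* Level [n.+1] has scale [6 * r <= 2 ^- n.+1 < 12 * r]: its intervals are long enough to contain
     a ball of radius [r], and [gamma] at this scale is below [gamma (12 * r)]. *)
  have [n /andP[nr rn]] : exists n, 2 ^- n.+1 < 12 * r <= 2 ^- n.
    by apply: dyadic_between; have := dy1 N; lra.
  have Nn : (N <= n.+1)%N.
    by apply: ltnW; rewrite -(dyadic_ltn R); lra.
  have rn' : 6 * r <= 2 ^- n.+1 by rewrite exprS invfM; lra.
  have gnr : gamma (2 ^- n.+1) < gamma (12 * r).
    by apply: gamma_incr => //; have := dy_r0 N (leqnn N); lra.
  have p78 := svc_ratio_ge78 tau01 tau_sum n.+1.
  have p1 := svc_ratio_le1 tau01 0 n.+1.
  have lt := svc_intervals_leftmost tau n.+1.
  set l := _ / _ in lt.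
  have lw : 2 * r <= l <= 2 ^- n.+1.
    have : 0 <= (svc_ratio tau 0 n.+1 - 7 / 8) * 2 ^- n.+1.
      by rewrite mulr_ge0 ?(ltW (dy0 _)) //; lra.
    have : 0 <= (1 - svc_ratio tau 0 n.+1) * 2 ^- n.+1.
      by rewrite mulr_ge0 ?(ltW (dy0 _)) //; lra.
    by rewrite /l; lra.
  have l0 : 0 < l by lra.
  (* The ball around the midpoint of [[0, l]] stays in it, as [2 * r <= l]. *)
  apply: (@inf_density_le _ _ (l / 2)) => //.
  apply: (@le_trans _ _ (lebesgue_measure (`[0, l] `\` svc_set tau))).
    have mK := measurable_svc_set tau.
    apply: le_measure; rewrite ?inE.
    + apply: measurableI; first exact: measurable_itv.
      exact: measurableC.
    + exact: measurableD.
    + move=> x [xl xK]; split=> //; move: xl.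
      by rewrite /interval_ball /= !in_itv /=; lra.
  apply: lebesgue_measure_svc_setC_le lt _ => // j.
  have := svc_ratio_ge tau01 n.+1 j; rewrite tau_tail //.
  have := gamma_gt0 (2 ^- (n.+1 + j)).
  rewrite dy0 dy_r0 ?(leq_trans Nn (leq_addr _ _)) // => /(_ isT) => g0 q.
  have g12 := gamma_gt0 (2 ^- n.+1) ltac:(by rewrite dy0 dy_r0).
  (* This product is [144 * gamma (12 * r)] times the length [2 * r] of the ball. *)
  have : l * (1 - svc_ratio tau n.+1 j) <= (12 * r) * (24 * gamma (12 * r)).
    apply: ler_pM; [lra| |lra|lra].
    by have := svc_ratio_le1 tau01 n.+1 j; lra.
  lra.
Unshelve. all: by end_near.
Qed.

(** * The general case, through a strictly increasing majorant *)

Theorem proposition20 (R : realType) (r0 : R) (gamma : R -> R)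
    (r0_gt0 : 0 < r0)
    (gamma01 : forall r, 0 < r <= r0 -> 0 <= gamma r <= 1)
    (gamma_cvg0 : gamma r @[r --> 0^'+] --> 0) :
  (exists omega : set R,
    [/\ measurable omega,
        (0 < lebesgue_measure (~` omega))%E
      & \forall r \near 0^'+, ((gamma r)%:E <= inf_density omega r)%E])
  /\
  ((forall r s, 0 < r -> r < s -> s <= r0 -> gamma r < gamma s) ->
   exists tau : nat -> R,
     (forall n, 0 < tau n < 1) /\
     (\forall n \near \oo,
        tau n = 24 * (gamma (2 ^- n) - gamma (2 ^- n.+1))) /\
     exists omega : set R,
       omega = ~` svc_set tau /\
       measurable omega /\
       (0 < lebesgue_measure (~` omega))%E /\
       (\forall r \near 0^'+, ((gamma r)%:E <= inf_density omega r)%E) /\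
       (\forall r \near 0^'+,
          (inf_density omega r <= (144 * gamma (12 * r))%:E)%E)).
Proof.
have mKC tau : measurable (~` svc_set tau : set R).
  by apply: measurableC; exact: measurable_svc_set.
split=> [|gamma_incr]; last first.
  have [tau [tau01 tauE K0 lo up]] :=
    svc_density r0_gt0 gamma01 gamma_cvg0 gamma_incr.
  exists tau; split=> //; split=> //; exists (~` svc_set tau).
  by rewrite setCK.
(* [r + sup_{s <= r} gamma s] is a strictly increasing majorant of [gamma]. *)
pose G r : set R := [set gamma s | s in [set s | 0 < s <= r]].
pose g r := r + sup (G r).
have gamma_small := cvg0_right_lt r0_gt0 gamma_cvg0.
have G_gamma r : 0 < r -> G r (gamma r) by move=> ?; exists r => //=; lra.
have ubG r e : (forall s, 0 < s <= r -> gamma s <= e) -> ubound (G r) e.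
  by move=> h _ [s /h ? <-].
have leG r : 0 < r <= r0 -> gamma r <= sup (G r).
  move=> rr0; apply: ub_le_sup; last by apply: G_gamma; lra.
  by exists 1; apply: ubG => s sr; have := gamma01 s; lra.
have Gle r e : 0 < r -> (forall s, 0 < s <= r -> gamma s <= e) -> sup (G r) <= e.
  by move=> rp h; apply: ge_sup; [exists (gamma r); exact: G_gamma|exact: ubG].
have [d /andP[d0 dr0] dP] : exists2 d, 0 < d <= r0 &
    forall r, 0 < r <= d -> gamma r < 1 / 2 by apply: gamma_small; lra.
(* Up to [r1] both summands of [g] are at most [1 / 2], so [g] takes its values in [[0, 1]]. *)
pose r1 := Num.min d (1 / 2).
have r1_gt0 : 0 < r1 by rewrite lt_min d0; lra.
have r1d : r1 <= d by rewrite ge_min lexx.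
have r1h : r1 <= 1 / 2 by rewrite ge_min lexx orbT.
have g01 r : 0 < r <= r1 -> 0 <= g r <= 1.
  move=> rr1; have rr0 : 0 < r <= r0 by lra.
  have := leG r rr0; have := gamma01 r rr0.
  have : sup (G r) <= 1 / 2 by apply: Gle => [|s sr]; [|apply/ltW/dP]; lra.
  by rewrite /g; lra.
(* The supremum is only nondecreasing; the summand [r] provides strictness. *)
have g_incr r s : 0 < r -> r < s -> s <= r1 -> g r < g s.
  move=> r_gt0 rs sr1; apply: ltr_leD => //.
  apply: Gle => // t tr; apply: ub_le_sup; last by exists t => //=; lra.
  by exists 1; apply: ubG => u us; have := gamma01 u; lra.
have g_cvg0 : g r @[r --> 0^'+] --> 0.
  apply/cvgrPdist_le => e e0.
  have [d' /andP[d'0 _] d'P] : exists2 d', 0 < d' <= r0 &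
    forall r, 0 < r <= d' -> gamma r < e / 2 by apply: gamma_small; lra.
  near=> r.
  have r_gt0 : 0 < r by [].
  have rd' : r < d' by near: r; exact: nbhs_right_lt.
  have re : r < e / 2 by near: r; apply: nbhs_right_lt; lra.
  have rr1 : r < r1 by near: r; exact: nbhs_right_lt.
  have : sup (G r) <= e / 2 by apply: Gle => // s sr; apply/ltW/d'P; lra.
  by have := g01 r; rewrite sub0r normrN ler_norml /g; lra.
have [tau [tau01 _ K0 lo _]] := svc_density r1_gt0 g01 g_cvg0 g_incr.
exists (~` svc_set tau); split=> //; first by rewrite setCK.
near=> r.
apply: (@le_trans _ _ (g r)%:E); last by near: r.
have r_gt0 : 0 < r by [].
have rr0 : r < r0 by near: r; exact: nbhs_right_lt.
by rewrite lee_fin /g; have := leG r; lra.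
Unshelve. all: by end_near.
Qed.
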